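(* Consider the constrained pricing problem under the multinomial logit (MNL) model, $$\max_{\mathbf{p}\in\mathcal{P}}\ \frac{\sum_{i\in[m]}p_i\exp(a_i-b_ip_i)}{1+\sum_{j\in[m]}\exp(a_j-b_jp_j)},\qquad \mathcal{P}=\Bigl\{\mathbf{p}\in\mathbb{R}^m: L_i\le p_i\le U_i\ \forall i\in[m],\ \sum_{i=1}^m\alpha_{ki}p_i\le\beta_k\ \forall k\in[K]\Bigr\},$$ with $b_i>0$, $\alpha_{ki}\ge 0$, $\mathcal{P}\ne\emptyset$, and let $\theta^\star$ denote its optimal value. Assume that the number of linear constraints satisfies $K=O(m)$. Then for any desired accuracy $\varepsilon>0$, the bisection scheme combined with exponential cone programming (described in the context) returns an approximate optimal parameter $\hat\theta$ such that $|\hat\theta-\theta^\star|\le\varepsilon$. Moreover, when each exponential cone subproblem is solved using a primal--dual interior-point method, the total arithmetic complexity of the algorithm is $O\bigl(m^{3.5}\log^2(\tfrac1\varepsilon)\bigr)$.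
   Context: $[m]=\{1,\dots,m\}$. For $\theta>0$ put $$G(\mathbf{p},\theta)=\sum_{i\in[m]}p_i\exp(a_i-b_ip_i)-\theta\Bigl(1+\sum_{j\in[m]}\exp(a_j-b_jp_j)\Bigr),\qquad \phi(\theta)=\max_{\mathbf{p}\in\mathcal{P}}G(\mathbf{p},\theta),$$ so that the pricing problem is recast as $\theta^\star=\max_{\theta>0}\{\theta:\phi(\theta)\ge0\}$. Bisection scheme. Start from an interval $[\theta_{\min},\theta_{\max}]$ guaranteed to contain $\theta^\star$. While $\theta_{\max}-\theta_{\min}$ exceeds the termination tolerance (of order $\varepsilon$), set $\theta=(\theta_{\min}+\theta_{\max})/2$ and compute $\phi(\theta)$ by solving the subproblem; if the computed value is $\ge0$ set $\theta_{\min}\leftarrow\theta$, otherwise set $\theta_{\max}\leftarrow\theta$. Return $\hat\theta=\theta_{\min}$. Each subproblem is solved numerically to accuracy $\Theta(\varepsilon)$. Exponential cone subproblem for fixed $\theta$ (obtained by the substitution $u_i=\exp(a_i-b_ip_i)$): $$\begin{aligned}\max_{\mathbf{u},\mathbf{s},\mathbf{v}}\ & -\theta+\sum_{i=1}^m\Bigl(\tfrac{a_i}{b_i}u_i-\tfrac1{b_i}s_i-\theta u_i\Bigr)\\ \text{s.t. } & \sum_{i=1}^m\tfrac{\alpha_{ki}}{b_i}v_i\ge\sum_{i=1}^m\tfrac{\alpha_{ki}a_i}{b_i}-\beta_k\ \ \forall k\in[K],\quad e^{a_i-b_iU_i}\le u_i\le e^{a_i-b_iL_i}\ \ \forall i\in[m],\\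 & (-s_i,u_i,1)\in\mathcal{K}_{\exp},\quad (v_i,1,u_i)\in\mathcal{K}_{\exp}\ \ \forall i\in[m],\end{aligned}$$ where $\mathcal{K}_{\exp}=\{(x,y,z): y>0,\ ye^{x/y}\le z\}\cup\{(x,0,z): x\le0,\ z\ge0\}$. Cost model for the interior-point method: a conic program with self-concordant barrier parameter $\nu$ (which is $\Theta(m)$ here, from $2m$ exponential cones each with parameter $3$) is solved to accuracy $\delta$ in $O(\sqrt{\nu}\log(1/\delta))$ Newton iterations, each costing $O(n^3)$ arithmetic operations, where $n=\Theta(m+K)$ is the problem dimension. *)

(* Defs.v *)
From HB Require Import structures.
From mathcomp Require Import all_boot all_order all_algebra.
From mathcomp Require Import all_classical all_reals all_analysis.
Set Implicit Arguments.
Unset Strict Implicit.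
Unset Printing Implicit Defensive.
Import Order.TTheory GRing.Theory Num.Theory.
Import numFieldNormedType.Exports.
Local Open Scope classical_set_scope.
Local Open Scope ring_scope.

Record mnl_data (R : realType) (m K : nat) := MnlData {
  mnl_a : 'I_m -> R;
  mnl_b : 'I_m -> R;
  mnl_L : 'I_m -> R;
  mnl_U : 'I_m -> R;
  mnl_alpha : 'I_K -> 'I_m -> R;
  mnl_beta : 'I_K -> R }.

Section Pricing.
Context {R : realType} {m K : nat}.
Variable I : mnl_data R m K.

Definition mnl_weight (p : 'rV[R]_m) (i : 'I_m) : R :=
  expR (mnl_a I i - mnl_b I i * p 0 i).

Definition mnl_revenue (p : 'rV[R]_m) : R :=
  (\sum_i p 0 i * mnl_weight p i) / (1 + \sum_j mnl_weight p j).

Definition mnl_prices : set 'rV[R]_m :=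
  [set p | (forall i, mnl_L I i <= p 0 i <= mnl_U I i) /\
           (forall k, \sum_i mnl_alpha I k i * p 0 i <= mnl_beta I k)].

Definition mnl_well_posed : Prop :=
  [/\ forall i, 0 < mnl_b I i,
      forall k i, 0 <= mnl_alpha I k i
    & mnl_prices !=set0].

(* [mnl_prices] is compact, so for a well-posed instance this supremum is a
   maximum. *)
Definition theta_star : R := sup [set mnl_revenue p | p in mnl_prices].

End Pricing.

Section AffineForms.
Context {R : realType} {V : finType}.

(* An affine form in the variables [V] is the pair of its coefficients and its
   constant term; addition and scaling are those of the product module. *)
Definition affine : lmodType R := ({ffun V -> R^o} * R^o)%type.

Definition aff_eval (f : affine) (x : V -> R) : R :=
  \sum_w f.1 w * x w + f.2.

Definition aff_var (w : V) : affine := ([ffun w' => (w' == w)%:R], 0).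

Definition aff_const (c : R) : affine := (0, c).

End AffineForms.
Arguments affine : clear implicits.

Definition K_exp {R : realType} : set (R * R * R) :=
  [set t | let: (x, y, z) := t in
     (0 < y /\ y * expR (x / y) <= z) \/ [/\ y = 0, x <= 0 & 0 <= z]].

(* Maximise [cp_obj] subject to [cp_lin r >= 0] for every linear row [r] and
   [cp_exp e \in K_exp] for every exponential row [e]. *)
Record conic_program (R : realType) := ConicProgram {
  cp_var : finType;
  cp_lrow : finType;
  cp_erow : finType;
  cp_obj : affine R cp_var;
  cp_lin : cp_lrow -> affine R cp_var;
  cp_exp : cp_erow -> affine R cp_var * affine R cp_var * affine R cp_var }.

Section ConicPrograms.
Context {R : realType}.
Variable Q : conic_program R.

Definition cp_feasible (x : cp_var Q -> R) : Prop :=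
  (forall r, 0 <= aff_eval (cp_lin r) x) /\
  (forall e : cp_erow Q, let: (f, g, h) := cp_exp e in
     K_exp (aff_eval f x, aff_eval g x, aff_eval h x)).

Definition cp_optimal (x : cp_var Q -> R) : Prop :=
  cp_feasible x /\
  forall y, cp_feasible y -> aff_eval (cp_obj Q) y <= aff_eval (cp_obj Q) x.

(* The standard barriers of the half-line and of the exponential cone have
   parameters 1 and 3, and parameters add up over products of cones. *)
Definition barrier_parameter : nat := (#|cp_lrow Q| + 3 * #|cp_erow Q|)%N.

(* Number of variables plus number of scalar conic rows. *)
Definition cp_dim : nat :=
  (#|cp_var Q| + (#|cp_lrow Q| + 3 * #|cp_erow Q|))%N.

End ConicPrograms.

Section Subproblem.
Context {R : realType} {m K : nat}.
Variables (I : mnl_data R m K) (theta : R).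

Let V : finType := ('I_m + 'I_m + 'I_m)%type.
Let u (i : 'I_m) : affine R V := aff_var (inl (inl i)).
Let s (i : 'I_m) : affine R V := aff_var (inl (inr i)).
Let v (i : 'I_m) : affine R V := aff_var (inr i).
Let a := mnl_a I.
Let b := mnl_b I.
Let alpha := mnl_alpha I.

(* Substitution [u i = expR (a i - b i * p i)]; the exponential rows say
   [u i * ln (u i) <= s i] and [v i <= ln (u i)], and at an optimum the
   objective is the value at [p] of
   [\sum_i p i * u i - theta * (1 + \sum_i u i)]. *)
Definition exp_cone_program : conic_program R :=
  @ConicProgram R V ('I_K + 'I_m + 'I_m)%type ('I_m + 'I_m)%type
    (aff_const (- theta) +
       \sum_i ((a i / b i) *: u i - (b i)^-1 *: s i - theta *: u i))
    (fun r => match r with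
      | inl (inl k) => \sum_i (alpha k i / b i) *: v i
          - aff_const (\sum_i alpha k i * a i / b i - mnl_beta I k)
      | inl (inr i) => u i - aff_const (expR (a i - b i * mnl_U I i))
      | inr i => aff_const (expR (a i - b i * mnl_L I i)) - u i
      end)
    (fun e => match e with
      | inl i => (- s i, u i, aff_const 1)
      | inr i => (v i, aff_const 1, u i)
      end).

End Subproblem.

Record solver_output (R : realType) := SolverOutput {
  out_value : R;
  (* numbers of arithmetic operations of the successive Newton iterations *)
  out_newton : seq nat }.

(* The second argument is the requested accuracy. *)
Definition conic_solver (R : realType) : Type :=
  conic_program R -> R -> solver_output R.

Definition accurate_solver {R : realType} (S : conic_solver R) : Prop :=
  forall (Q : conic_program R) (x : cp_var Q -> R) (delta : R),
    0 < delta -> cp_optimal x ->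
    `|out_value (S Q delta) - aff_eval (cp_obj Q) x| <= delta.

(* [O(sqrt nu * log (1 / delta))] Newton iterations of cost [O(n ^ 3)] each,
   with hidden constants [cN] and [cL], for accuracies in [(0, eps0]]. *)
Definition ipm_cost_model {R : realType} (eps0 cN cL : R)
    (S : conic_solver R) : Prop :=
  forall (Q : conic_program R) (x : cp_var Q -> R) (delta : R),
    0 < delta <= eps0 -> cp_optimal x ->
    (size (out_newton (S Q delta)))%:R
      <= cN * Num.sqrt (barrier_parameter Q)%:R * ln (delta^-1) /\
    (forall c, c \in out_newton (S Q delta) ->
      c%:R <= cL * (cp_dim Q)%:R ^+ 3).

(* Big-step semantics of the loop: [bisection tol query lo hi th c] means that
   the loop started from [lo, hi] halts, returning [th] after [c] arithmetic
   operations; [query th] is the computed subproblem value and its cost.  The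
   loop guard costs 2 operations, the midpoint 2 and the sign test 1. *)
Inductive bisection {R : realType} (tol : R) (query : R -> R * nat) :
    R -> R -> R -> nat -> Prop :=
| bisection_stop (lo hi : R) : hi - lo <= tol -> bisection tol query lo hi lo 2
| bisection_up (lo hi th : R) (c : nat) :
    let mid := (lo + hi) / 2 in
    tol < hi - lo -> 0 <= (query mid).1 ->
    bisection tol query mid hi th c ->
    bisection tol query lo hi th (5 + (query mid).2 + c)%N
| bisection_down (lo hi th : R) (c : nat) :
    let mid := (lo + hi) / 2 in
    tol < hi - lo -> (query mid).1 < 0 ->
    bisection tol query lo mid th c ->
    bisection tol query lo hi th (5 + (query mid).2 + c)%N.

(* [cB * n ^ 2] operations are charged for assembling the coefficients of the
   program, of which there are at most [n ^ 2]. *)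
Definition subproblem_query {R : realType} {m K : nat} (I : mnl_data R m K)
    (S : conic_solver R) (cB : nat) (delta : R) (theta : R) : R * nat :=
  let Q := exp_cone_program I theta in
  let out := S Q delta in
  (out_value out, (cB * cp_dim Q ^ 2 + sumn (out_newton out))%N).

Definition mnl_bisection {R : realType} {m K : nat} (I : mnl_data R m K)
    (S : conic_solver R) (cB : nat) (tol delta : R) :
    R -> R -> R -> nat -> Prop :=
  bisection tol (subproblem_query I S cB delta).

(* Main.v *)
Require Import Defs.
From HB Require Import structures.
From mathcomp Require Import all_boot all_order all_algebra.
From mathcomp Require Import all_classical all_reals all_analysis.
From mathcomp Require Import ring lra zify.
Set Implicit Arguments.
Unset Strict Implicit.
Unset Printing Implicit Defensive.
Import Order.TTheory GRing.Theory Num.Theory.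
Import numFieldNormedType.Exports.
Local Open Scope classical_set_scope.
Local Open Scope ring_scope.

(** The revenue of a price vector [p] is a ratio [N p / D p] with [D p >= 1],
    so comparing it with [theta] amounts to comparing the surplus
    [N p - theta * D p] with [0].  As [D p >= 1], the surplus changes at unit
    rate or faster when [theta] moves: an error [d] in the maximal surplus
    displaces the threshold [theta_star] by at most [d]
    ([theta_star_ge], [theta_star_le]).

    The maximal surplus at [theta] is the optimal value of the exponential cone
    program.  A price vector lifts to a feasible point whose objective is its
    surplus; conversely, reading prices off the [u] coordinates of a feasible
    point gives admissible prices of no smaller surplus.  The linear rows bound
    [v] instead of [ln u], and [v <= ln u]; since [alpha >= 0], replacing [v]
    by [ln u] only helps.  Since the surplus is continuous on the compact price
    set, a maximiser exists, and its lift is an optimal point of the program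
    ([exp_cone_optimal]); hence the accuracy assumption on the solver applies
    at every midpoint.

    Each sign test of the bisection is therefore right up to [delta], and
    [lo - delta <= theta_star <= hi + delta] is a loop invariant
    ([bisection_localizes]).  On exit [hi - lo <= tol], so the answer is within
    [tol + delta <= eps].  The interval halves at each turn, so
    [O (ln (1 / eps))] turns suffice ([halving_count], [bisection_cost]).  One
    turn solves a program of dimension [11 * m + K] and barrier parameter
    [8 * m + K], both [O (m)], in [O (sqrt m * ln (1 / eps))] Newton steps of
    cost [O (m ^ 3)] ([query_cost_asymptotic]); the product of the two bounds is
    the claimed complexity. *)

(** * The pricing problem and its parametric form *)

Section ParametricPricing.
Context {R : realType} {m K : nat}.
Variable I : mnl_data R m K.

(** The objective [G] of the Dinkelbach-type parametric problem attached to the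
    revenue ratio. *)
Definition mnl_surplus (theta : R) (p : 'rV[R]_m) : R :=
  \sum_i p 0 i * mnl_weight I p i - theta * (1 + \sum_j mnl_weight I p j).

Lemma mnl_denominator_ge1 p : 1 <= 1 + \sum_j mnl_weight I p j.
Proof. by rewrite lerDl sumr_ge0// => j _; exact: expR_ge0. Qed.

Lemma mnl_surplusE theta p :
  mnl_surplus theta p =
    (mnl_revenue I p - theta) * (1 + \sum_j mnl_weight I p j).
Proof.
rewrite mulrBl divfK// gt_eqF// (lt_le_trans ltr01)//.
exact: mnl_denominator_ge1.
Qed.

Lemma continuous_big_add (V : topologicalType) (J : Type) (r : seq J)
    (f : J -> V -> R) :
  (forall j, continuous (f j)) -> continuous (fun x => \sum_(j <- r) f j x).
Proof.
move=> cf; elim: r => [|j r IH] x.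
  by under eq_fun do rewrite big_nil; exact: cvg_cst.
under eq_fun do rewrite big_cons.
by apply: cvgD; [exact: cf|exact: IH].
Qed.

(** The box is compact, and the linear rows cut out a closed subset of it. *)
Lemma mnl_prices_compact : compact (mnl_prices I).
Proof.
pose box := [set p : 'rV[R]_m |
  forall i, `[mnl_L I i, mnl_U I i]%classic (p ord0 i)].
have boxc : compact box.
  exact: (@rV_compact R m (fun i => `[mnl_L I i, mnl_U I i]%classic)
    (fun i => @segment_compact _ _ _)).
have box_closed : closed box.
  rewrite (_ : box = \bigcap_(i in setT)
      (fun p : 'rV[R]_m => p ord0 i) @^-1` `[mnl_L I i, mnl_U I i]%classic).
    apply: closed_bigI => i _; apply: preimage_closed; last exact: itv_closed.
    by move=> p _; exact: coord_continuous.
  by apply/seteqP; split => [p + i _|p + i]; [exact|move/(_ i Logic.I)].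
pose poly := \bigcap_(k in setT)
  (fun p : 'rV[R]_m => \sum_i mnl_alpha I k i * p 0 i) @^-1`
    [set x | x <= mnl_beta I k].
have poly_closed : closed poly.
  apply: closed_bigI => k _; apply: preimage_closed; last exact: closed_le.
  move=> p _; apply: continuous_big_add => i x.
  exact: cvgM (cvg_cst _) (@coord_continuous _ _ _ _ _ x).
apply: (subclosed_compact _ boxc).
  rewrite (_ : mnl_prices I = box `&` poly); first exact: closedI.
  apply/seteqP; split => p [pb pl]; split => // k; last exact: pl.
  by move=> _; exact: pl.
by move=> p [pb _] i; rewrite /= in_itv/= pb.
Qed.

Lemma mnl_weight_continuous i :
  continuous (fun p : 'rV[R]_m => mnl_weight I p i).
Proof.
move=> p; apply: (@continuous_comp _ _ _
  (fun q : 'rV[R]_m => mnl_a I i - mnl_b I i * q 0 i) expR).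
  exact: cvgB (cvg_cst _) (cvgM (cvg_cst _) (@coord_continuous _ _ _ _ _ p)).
exact: continuous_expR.
Qed.

Lemma mnl_surplus_continuous theta : continuous (mnl_surplus theta).
Proof.
have c1 : continuous (fun p : 'rV[R]_m => \sum_i p 0 i * mnl_weight I p i).
  apply: continuous_big_add => i p.
  exact: cvgM (@coord_continuous _ _ _ _ _ p) (@mnl_weight_continuous i p).
have c2 : continuous (fun p : 'rV[R]_m => \sum_i mnl_weight I p i).
  by apply: continuous_big_add => i p; exact: mnl_weight_continuous.
move=> p.
exact: cvgB (c1 p) (cvgM (cvg_cst _) (cvgD (cvg_cst _) (c2 p))).
Qed.

Lemma mnl_surplus_max theta : mnl_prices I !=set0 ->
  exists2 p, mnl_prices I p &
    forall q, mnl_prices I q -> mnl_surplus theta q <= mnl_surplus theta p.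
Proof.
move=> P0.
have [|p pP pmax] := EVT_max_rV P0 mnl_prices_compact (f := mnl_surplus theta).
  by apply: continuous_subspaceT; exact: mnl_surplus_continuous.
by exists p => [|q qP]; [exact/set_mem|apply: pmax; exact/mem_set].
Qed.

(** The revenue is bounded above, so the supremum is a genuine upper bound: the
    numerator is at most the maximal surplus at [theta = 0], and dividing by a
    denominator that is at least [1] only decreases a nonnegative number. *)
Lemma mnl_revenue_le_theta_star p :
  mnl_prices I p -> mnl_revenue I p <= theta_star I.
Proof.
move=> pP; apply: ub_le_sup; last by exists p.
have [|q qP qmax] := mnl_surplus_max 0; first by exists p.
exists (Num.max 0 (mnl_surplus 0 q)) => _ [r rP <-].
have := le_trans (qmax _ rP) _; move/(_ (Num.max 0 (mnl_surplus 0 q))).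
rewrite le_max lexx orbT => /(_ isT); rewrite mnl_surplusE subr0.
have D1 := mnl_denominator_ge1 r; set D := 1 + _ in D1 *.
have M0 : 0 <= Num.max 0 (mnl_surplus 0 q) by rewrite le_max lexx.
set M := Num.max _ _ in M0 *; move=> rDM.
have [r0|r0] := leP (mnl_revenue I r) 0; first exact: le_trans r0 M0.
by apply: le_trans rDM; rewrite ler_peMr// ltW.
Qed.

(** Dividing a surplus deficit [d] by a denominator that is at least [1] leaves a
    revenue deficit of at most [d]; the next lemma is the opposite bound. *)
Lemma theta_star_ge (theta d : R) p : 0 <= d -> mnl_prices I p ->
  - d <= mnl_surplus theta p -> theta - d <= theta_star I.
Proof.
move=> d0 pP; rewrite mnl_surplusE => h.
apply: le_trans (mnl_revenue_le_theta_star pP).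
have D1 := mnl_denominator_ge1 p; set D := 1 + _ in D1 h *.
nra.
Qed.

Lemma theta_star_le (theta d : R) : 0 <= d -> mnl_prices I !=set0 ->
  (forall p, mnl_prices I p -> mnl_surplus theta p <= d) ->
  theta_star I <= theta + d.
Proof.
move=> d0 [p0 p0P] h; apply: ge_sup; first by exists (mnl_revenue I p0), p0.
move=> _ [p pP <-]; have := h p pP; rewrite mnl_surplusE => hp.
have D1 := mnl_denominator_ge1 p; set D := 1 + _ in D1 hp *.
nra.
Qed.

End ParametricPricing.

(** * The exponential cone program *)

Section AffineEvaluation.
Context {R : realType} {V : finType}.
Implicit Types (f g : affine R V) (x : V -> R).

Lemma aff_evalD f g x : aff_eval (f + g) x = aff_eval f x + aff_eval g x.
Proof.
rewrite /aff_eval /= addrACA -big_split/=; congr (_ + _).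
by apply: eq_bigr => w _; rewrite ffunE mulrDl.
Qed.

Lemma aff_evalZ c f x : aff_eval (c *: f) x = c * aff_eval f x.
Proof.
rewrite /aff_eval /= mulrDr mulr_sumr; congr (_ + _).
by apply: eq_bigr => w _; rewrite ffunE -mulrA.
Qed.

Lemma aff_evalN f x : aff_eval (- f) x = - aff_eval f x.
Proof. by rewrite -scaleN1r aff_evalZ mulN1r. Qed.

Lemma aff_eval_const c x : aff_eval (aff_const c) x = c.
Proof.
by rewrite /aff_eval big1 ?add0r// => w _; rewrite ffunE mul0r.
Qed.

Lemma aff_eval_var w x : aff_eval (aff_var w) x = x w.
Proof.
rewrite /aff_eval addr0 (bigD1 w)//= ffunE eqxx mul1r big1 ?addr0// => w' w'w.
by rewrite ffunE (negbTE w'w) mul0r.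
Qed.

Lemma aff_eval_sum (J : Type) (r : seq J) (F : J -> affine R V) x :
  aff_eval (\sum_(j <- r) F j) x = \sum_(j <- r) aff_eval (F j) x.
Proof.
elim: r => [|j r IH]; last by rewrite !big_cons aff_evalD IH.
by rewrite !big_nil -(aff_eval_const 0 x).
Qed.

Definition aff_evalE := (aff_evalD, aff_evalN, aff_evalZ, aff_eval_sum,
  aff_eval_const, aff_eval_var).

End AffineEvaluation.

Section ExponentialCone.
Context {R : realType}.
Implicit Types u s v : R.

(** Since [u > 0] excludes the degenerate face, membership reads
    [u * expR (- s / u) <= 1], and taking logarithms gives the entropy bound. *)
Lemma K_exp_entropy u s : 0 < u -> K_exp (- s, u, 1) <-> u * ln u <= s.
Proof.
move=> u0; have -> : K_exp (- s, u, 1) <-> u * expR (- s / u) <= 1.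
  by split=> [[[]//|[u00]]|h]; [rewrite u00 ltxx in u0|left].
rewrite mulrC -ler_pdivlMr// div1r.
rewrite -[X in _ <= X <-> _]lnK ?posrE ?invr_gt0// ler_expR.
by rewrite lnV ?posrE// ler_pdivrMr// mulNr lerN2 mulrC.
Qed.

Lemma K_exp_log u v : 0 < u -> K_exp (v, 1, u) <-> v <= ln u.
Proof.
move=> u0; have -> : K_exp (v, 1, u) <-> expR v <= u.
  rewrite /K_exp/= mul1r divr1; split=> [[[]//|[/eqP]]|h]; last by left.
  by rewrite oner_eq0.
by rewrite -[X in _ <= X](lnK) ?posrE// ler_expR.
Qed.

End ExponentialCone.

Section Subproblem.
Context {R : realType} {m K : nat}.
Variables (I : mnl_data R m K) (theta : R).
Hypothesis b_gt0 : forall i, 0 < mnl_b I i.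

Notation Q := (exp_cone_program I theta).
Notation uu x i := (x (inl (inl i))).
Notation ss x i := (x (inl (inr i))).
Notation vv x i := (x (inr i)).

Lemma exp_cone_objE (x : cp_var Q -> R) :
  aff_eval (cp_obj Q) x = - theta +
    \sum_i (mnl_a I i / mnl_b I i * uu x i - (mnl_b I i)^-1 * ss x i
            - theta * uu x i).
Proof.
rewrite /= !aff_evalE; congr (_ + _); apply: eq_bigr => i _.
by rewrite !aff_evalE.
Qed.

Lemma exp_cone_feasibleP (x : cp_var Q -> R) :
  cp_feasible x <->
  [/\ forall k, \sum_i mnl_alpha I k i * mnl_a I i / mnl_b I i - mnl_beta I k
        <= \sum_i mnl_alpha I k i / mnl_b I i * vv x i,
      forall i, expR (mnl_a I i - mnl_b I i * mnl_U I i) <= uu x i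
        <= expR (mnl_a I i - mnl_b I i * mnl_L I i),
      forall i, uu x i * ln (uu x i) <= ss x i
    & forall i, vv x i <= ln (uu x i)].
Proof.
split=> [[lin cone]|[hk hu hs hv]].
  have hu i : expR (mnl_a I i - mnl_b I i * mnl_U I i) <= uu x i
        <= expR (mnl_a I i - mnl_b I i * mnl_L I i).
    have := lin (inl (inr i)); have := lin (inr i).
    by rewrite /= !aff_evalE !subr_ge0 => -> ->.
  have u0 i : 0 < uu x i.
    by case/andP: (hu i) => h _; exact: lt_le_trans (expR_gt0 _) h.
  split=> // [k|i|i].
  - have := lin (inl (inl k)); rewrite /= !aff_evalE subr_ge0.
    by under [X in _ <= X -> _]eq_bigr do rewrite !aff_evalE.
  - by have := cone (inl i); rewrite /= !aff_evalE => /K_exp_entropy; exact.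
  - by have := cone (inr i); rewrite /= !aff_evalE => /K_exp_log; exact.
have u0 i : 0 < uu x i.
  by case/andP: (hu i) => h _; exact: lt_le_trans (expR_gt0 _) h.
split=> [[[k|i]|i]|[i|i]] /=; rewrite !aff_evalE ?subr_ge0.
- by under [leRHS]eq_bigr do rewrite !aff_evalE; exact: hk.
- by case/andP: (hu i).
- by case/andP: (hu i).
- exact: (iffRL (K_exp_entropy _ (u0 i)) (hs i)).
- exact: (iffRL (K_exp_log _ (u0 i)) (hv i)).
Qed.

(** The lift makes both families of exponential rows tight: [v = ln u] and
    [s = u * ln u]. *)
Definition cone_point (p : 'rV[R]_m) : cp_var Q -> R := fun w =>
  match w with
  | inl (inl i) => mnl_weight I p i
  | inl (inr i) => mnl_weight I p i * (mnl_a I i - mnl_b I i * p 0 i)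
  | inr i => mnl_a I i - mnl_b I i * p 0 i
  end.

Lemma cone_point_feasible p : mnl_prices I p -> cp_feasible (cone_point p).
Proof.
move=> [pb pl]; apply/exp_cone_feasibleP; split=> [k|i|i|i] /=; last 2 first.
- by rewrite expRK.
- by rewrite expRK.
- rewrite lerBlDr -lerBlDl; apply: le_trans (pl k); rewrite -sumrB.
  apply: ler_sum => i _; have bi := b_gt0 i.
  rewrite le_eqVlt; apply/orP; left; apply/eqP; field; exact: lt0r_neq0.
- by rewrite !ler_expR !lerB// ler_pM2l//; case/andP: (pb i).
Qed.

Lemma cone_point_obj p :
  aff_eval (cp_obj Q) (cone_point p) = mnl_surplus I theta p.
Proof.
rewrite exp_cone_objE /mnl_surplus mulrDr mulr1 mulr_sumr opprD addrCA -sumrB.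
congr (_ + _); apply: eq_bigr => i _ /=; have bi := b_gt0 i.
by field; exact: lt0r_neq0.
Qed.

(** The inverse of the substitution [u = expR (a - b * p)]. *)
Definition cone_price (x : cp_var Q -> R) : 'rV[R]_m :=
  \row_i ((mnl_a I i - ln (uu x i)) / mnl_b I i).

Lemma cone_price_weight x i : 0 < uu x i ->
  mnl_weight I (cone_price x) i = uu x i.
Proof.
move=> u0; rewrite /mnl_weight mxE mulrC divfK ?lt0r_neq0// opprB addrC subrK.
by rewrite lnK ?posrE.
Qed.

(** This is where [alpha >= 0] enters: the linear rows are imposed on
    [(a - v) / b], which dominates the price [(a - ln u) / b] because
    [v <= ln u]. *)
Lemma cone_price_feasible x : (forall k i, 0 <= mnl_alpha I k i) ->
  cp_feasible x -> mnl_prices I (cone_price x).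
Proof.
move=> alpha0 /exp_cone_feasibleP[hk hu _ hv].
have u0 i : 0 < uu x i.
  by case/andP: (hu i) => h _; exact: lt_le_trans (expR_gt0 _) h.
split=> [i|k].
  have := hu i; rewrite -[uu x i]lnK ?posrE// !ler_expR => /andP[lU lL].
  by rewrite mxE ler_pdivlMr// ler_pdivrMr//; lra.
have := hk k; rewrite lerBlDr -lerBlDl; apply: le_trans.
rewrite -sumrB; apply: ler_sum => i _; rewrite mxE.
have -> : mnl_alpha I k i * mnl_a I i / mnl_b I i -
    mnl_alpha I k i / mnl_b I i * vv x i =
    mnl_alpha I k i * ((mnl_a I i - vv x i) / mnl_b I i).
  by have bi := b_gt0 i; field; exact: lt0r_neq0.
by rewrite ler_wpM2l// ler_pM2r ?invr_gt0// lerB.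
Qed.

(** The objective charges [s / b] where the surplus charges [u * ln u / b], and
    [u * ln u <= s]. *)
Lemma cone_price_surplus x : cp_feasible x ->
  aff_eval (cp_obj Q) x <= mnl_surplus I theta (cone_price x).
Proof.
move=> /exp_cone_feasibleP[hk hu hs hv].
rewrite exp_cone_objE /mnl_surplus mulrDr mulr1 mulr_sumr opprD addrCA -sumrB.
rewrite lerD2l; apply: ler_sum => i _.
have u0 : 0 < uu x i.
  by case/andP: (hu i) => h _; exact: lt_le_trans (expR_gt0 _) h.
rewrite cone_price_weight// mxE lerD2r.
have -> : (mnl_a I i - ln (uu x i)) / mnl_b I i * uu x i =
  mnl_a I i / mnl_b I i * uu x i - (mnl_b I i)^-1 * (uu x i * ln (uu x i)).
  by have bi := b_gt0 i; field; exact: lt0r_neq0.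
by rewrite lerB// ler_wpM2l// invr_ge0 ltW.
Qed.

Lemma exp_cone_optimal p : (forall k i, 0 <= mnl_alpha I k i) ->
  mnl_prices I p ->
  (forall q, mnl_prices I q ->
    mnl_surplus I theta q <= mnl_surplus I theta p) ->
  cp_optimal (cone_point p).
Proof.
move=> alpha0 pP pmax; split; first exact: cone_point_feasible.
move=> x xF; rewrite cone_point_obj (le_trans (cone_price_surplus xF))//.
exact/pmax/cone_price_feasible.
Qed.

End Subproblem.
Arguments cone_point {R m K} I theta p _.

Section SubproblemSize.
Context {R : realType} {m K : nat}.
Variables (I : mnl_data R m K) (theta : R).

Lemma exp_cone_dim : cp_dim (exp_cone_program I theta) = (11 * m + K)%N.
Proof. by rewrite /cp_dim /= !card_sum !card_ord; lia. Qed.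

Lemma exp_cone_barrier :
  barrier_parameter (exp_cone_program I theta) = (8 * m + K)%N.
Proof. by rewrite /barrier_parameter /= !card_sum !card_ord; lia. Qed.

End SubproblemSize.

(** * Bisection with an inexact oracle *)

Section Bisection.
Context {R : realType}.
Variables (tol : R) (query : R -> R * nat).
Hypothesis tol_gt0 : 0 < tol.

(** Induction on the number of halvings still needed; the two sign cases leave
    intervals of the same length. *)
Lemma bisection_halts_within (n : nat) (lo hi : R) :
  hi - lo <= 2 ^+ n * tol -> exists th c, bisection tol query lo hi th c.
Proof.
elim: n lo hi => [|n IH] lo hi h.
  by exists lo, 2%N; apply: bisection_stop; rewrite expr0 mul1r in h.
have [stop|go] := leP (hi - lo) tol.
  by exists lo, 2%N; exact: bisection_stop.
rewrite exprS -mulrA in h.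
have [up|down] := leP 0 (query ((lo + hi) / 2)).1.
  have [|th [c run]] := IH ((lo + hi) / 2) hi; first lra.
  by exists th; eexists; exact: (bisection_up go up run).
have [|th [c run]] := IH lo ((lo + hi) / 2); first lra.
by exists th; eexists; exact: (bisection_down go down run).
Qed.

Lemma bisection_halts (lo hi : R) :
  exists th c, bisection tol query lo hi th c.
Proof.
apply: (@bisection_halts_within (Num.truncn (`|hi - lo| / tol)).+1).
rewrite -ler_pdivrMr//; apply: (@le_trans _ _ (`|hi - lo| / tol)).
  by rewrite ler_pM2r ?invr_gt0// ler_norm.
apply: le_trans (ltW (truncnS_gt _)) _.
by rewrite -natrX ler_nat ltnW// ltn_expl.
Qed.

(** The hypotheses on [query] say that a sign test errs by at most [d] about the
    position of [theta].  Each endpoint is either initial or was tested, so the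
    errors do not accumulate over the iterations. *)
Lemma bisection_localizes (d theta : R) (lo hi th : R) (c : nat) :
  (forall t, 0 <= (query t).1 -> t - d <= theta) ->
  (forall t, (query t).1 < 0 -> theta <= t + d) ->
  bisection tol query lo hi th c ->
  lo - d <= theta <= hi + d -> th - d <= theta <= th + (tol + d).
Proof.
move=> qup qdown; elim=> {lo hi th c}
  [lo hi stop|lo hi th c mid go up _ IH|lo hi th c mid go down _ IH] /andP[l h].
- by apply/andP; split; lra.
- by apply: IH; rewrite qup.
- by apply: IH; rewrite l qdown.
Qed.

(** An iteration costs [5] operations plus one query, and the final guard costs
    [2]; at most [n] iterations happen as each one halves the interval. *)
Lemma bisection_cost (n : nat) (q : R) (lo hi th : R) (c : nat) :
  0 <= q -> (forall t, (query t).2%:R <= q) ->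
  bisection tol query lo hi th c ->
  hi - lo <= 2 ^+ n * tol -> c%:R <= 2 + n%:R * (5 + q).
Proof.
move=> q0 hq run; elim: run n => {lo hi th c}
  [lo hi stop|lo hi th c mid go _ _ IH|lo hi th c mid go _ _ IH] n h.
- by rewrite lerDl mulr_ge0// addr_ge0.
- case: n h => [|n] h; first by rewrite expr0 mul1r leNgt go in h.
  rewrite exprS -mulrA in h.
  have := IH n; have -> : hi - mid = (hi - lo) / 2 by rewrite /mid; field.
  move=> /(_ ltac:(lra)) hc; have := hq mid.
  by rewrite !natrD -natr1 => hm; lra.
- case: n h => [|n] h; first by rewrite expr0 mul1r leNgt go in h.
  rewrite exprS -mulrA in h.
  have := IH n; have -> : mid - lo = (hi - lo) / 2 by rewrite /mid; field.
  move=> /(_ ltac:(lra)) hc; have := hq mid.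
  by rewrite !natrD -natr1 => hm; lra.
Qed.

End Bisection.

(** * The subproblem as an inexact sign oracle *)

Section Query.
Context {R : realType} {m K : nat}.
Variables (I : mnl_data R m K) (S : conic_solver R) (cB : nat) (delta : R).
Hypothesis wpI : mnl_well_posed I.
Hypothesis delta_gt0 : 0 < delta.

Notation query := (subproblem_query I S cB delta).

(** The accuracy and cost assumptions on the solver speak only of programs that
    attain their optimum; this supplies the attained optimum. *)
Lemma exp_cone_solution theta : exists2 p, mnl_prices I p &
  (forall q, mnl_prices I q ->
    mnl_surplus I theta q <= mnl_surplus I theta p) /\
  cp_optimal (cone_point I theta p).
Proof.
case: wpI => b0 alpha0 P0; have [p pP pmax] := mnl_surplus_max theta P0.
by exists p => //; split=> //; exact: exp_cone_optimal.
Qed.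

Lemma query_up theta : accurate_solver S ->
  0 <= (query theta).1 -> theta - delta <= theta_star I.
Proof.
move=> acc out0; case: (wpI) => b0 _ _.
have [p pP [_ popt]] := exp_cone_solution theta.
apply: (theta_star_ge (ltW delta_gt0) pP).
have := acc _ _ _ delta_gt0 popt; rewrite cone_point_obj// ler_norml.
by move: out0 => /= out0 /andP[_ h]; lra.
Qed.

Lemma query_down theta : accurate_solver S ->
  (query theta).1 < 0 -> theta_star I <= theta + delta.
Proof.
move=> acc out0; case: (wpI) => b0 _ P0.
have [p pP [pmax popt]] := exp_cone_solution theta.
apply: (theta_star_le (ltW delta_gt0) P0) => q /pmax qp; apply: le_trans qp _.
have := acc _ _ _ delta_gt0 popt; rewrite cone_point_obj// ler_norml.
by move: out0 => /= out0 /andP[h _]; lra.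
Qed.

Lemma sumn_le_size (s : seq nat) (B : R) :
  (forall c, c \in s -> c%:R <= B) -> (sumn s)%:R <= (size s)%:R * B.
Proof.
elim: s => [|c s IH] h; first by rewrite mul0r.
rewrite /= natrD -natr1 mulrDl mul1r addrC lerD// ?h ?mem_head//.
by apply: IH => c' c's; rewrite h// in_cons c's orbT.
Qed.

Lemma query_cost (eps0 cN cL : R) theta : 0 <= cL ->
  ipm_cost_model eps0 cN cL S -> delta <= eps0 ->
  (query theta).2%:R <= cB%:R * (11 * m + K)%:R ^+ 2 +
    cN * Num.sqrt (8 * m + K)%:R * ln (delta^-1) *
    (cL * (11 * m + K)%:R ^+ 3).
Proof.
move=> cL0 cost de; have [p _ [_ popt]] := exp_cone_solution theta.
have := cost _ _ delta _ popt; rewrite delta_gt0 de => /(_ isT)[hsize hcost].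
rewrite -(exp_cone_dim I theta) -(exp_cone_barrier I theta).
rewrite /subproblem_query /= natrD natrM natrX lerD2l.
apply: le_trans (sumn_le_size hcost) _.
by rewrite ler_wpM2r// mulr_ge0// exprn_ge0.
Qed.

End Query.

(** * Asymptotic bookkeeping *)

Section Asymptotics.
Context {R : realType}.

(** Because [eps] stays below [eps0 < 1], [ln (1 / eps)] is bounded away from
    [0], so that constants can be absorbed into its multiples. *)
Lemma le_log_scaled (eps0 eps x : R) : 0 < eps -> eps <= eps0 -> eps0 < 1 ->
  0 <= x -> x <= x / ln (eps0^-1) * ln (eps^-1).
Proof.
move=> e0 ee0 e01 x0; have e00 : 0 < eps0 by exact: lt_le_trans ee0.
have l0 : 0 < ln (eps0^-1).
  by rewrite ln_gt0// invf_gt1.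
rewrite mulrAC ler_pdivlMr// ler_wpM2l// ler_ln ?posrE ?invr_gt0//.
by rewrite lef_pV2 ?posrE.
Qed.

(** Any [n] above [log2 (W / (c * eps))] works; the absolute value of
    [ln (W / c)] keeps the truncated number nonnegative when [c > W]. *)
Lemma halving_count (eps0 W c : R) : 0 < eps0 < 1 -> 0 < W -> 0 < c ->
  exists2 A : R, 0 <= A & forall eps, 0 < eps -> eps <= eps0 ->
    exists2 n : nat, W <= 2 ^+ n * (c * eps) & n%:R <= A * ln (eps^-1).
Proof.
move=> /andP[e00 e01] W0 c0; pose w := `|ln (W / c)|.
have l0 : 0 < ln (eps0^-1) by rewrite ln_gt0// invf_gt1.
have w0 : 0 <= w by exact: normr_ge0.
have l2 : 0 < ln (2 : R) by rewrite ln_gt0// ltr1n.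
exists ((w / ln (eps0^-1) + 1) / ln 2 + 1 / ln (eps0^-1)).
  by rewrite !(addr_ge0, divr_ge0)// ltW.
move=> eps e0 ee0; pose x := (w + ln (eps^-1)) / ln 2.
have le0 : 0 <= ln (eps^-1).
  by rewrite ln_ge0// invf_ge1// (le_trans ee0)// ltW.
have x0 : 0 <= x by rewrite divr_ge0 ?addr_ge0// ltW.
exists (Num.truncn x).+1.
  rewrite mulrA -ler_pdivrMr// -ler_pdivrMr//.
  have -> : W / eps / c = W / c * eps^-1 by rewrite mulrAC.
  rewrite -[2 in leRHS]lnK ?posrE// -expRM_natr.
  rewrite -[leLHS]lnK ?posrE ?mulr_gt0 ?invr_gt0// ler_expR.
  rewrite lnM ?posrE ?mulr_gt0 ?invr_gt0// [leRHS]mulrC -ler_pdivrMr//.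
  apply: le_trans (ltW (truncnS_gt x)).
  by rewrite ler_pM2r ?invr_gt0// lerD2r ler_norm.
rewrite -natr1 mulrDl lerD//; last exact: le_log_scaled.
have : (Num.truncn x)%:R <= x by rewrite truncn_le.
move=> /le_trans; apply; rewrite /x mulrAC ler_pM2r ?invr_gt0//.
by rewrite mulrDl mul1r lerD2r; exact: le_log_scaled.
Qed.

Lemma powR_seven_halves (x : R) : 0 < x -> x `^ (7 / 2) = x ^+ 3 * Num.sqrt x.
Proof.
move=> x0; have -> : 7 / 2 = 3%:R + 2^-1 :> R by field.
by rewrite powRD ?powR_mulrn ?powR12_sqrt ?ltW// gt_eqF// implybT.
Qed.

(** With [K <= kappa * m], the dimension is at most [(11 + kappa) * m] and the
    barrier parameter at most [(8 + kappa) * m]; the exponent [7 / 2] is the sum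
    of [3] from the Newton steps and [1 / 2] from the barrier.  The [m ^ 2] cost
    of assembling the program is absorbed as [m >= 1], and [ln (1 / c)] as
    [ln (1 / eps)] is bounded below. *)
Lemma query_cost_asymptotic (eps0 kappa cN cL c : R) (cB : nat) :
  0 < eps0 < 1 -> 0 < kappa -> 0 < cN -> 0 < cL -> 0 < c <= 1 ->
  exists2 A : R, 0 <= A & forall (m K : nat) eps,
    (0 < m)%N -> K%:R <= kappa * m%:R -> 0 < eps -> eps <= eps0 ->
    5 + (cB%:R * (11 * m + K)%:R ^+ 2 +
      cN * Num.sqrt (8 * m + K)%:R * ln ((c * eps)^-1) *
      (cL * (11 * m + K)%:R ^+ 3)) <= A * (m%:R `^ (7 / 2) * ln (eps^-1)).
Proof.
move=> /andP[e00 e01] k0 N0 L0 /andP[c0 c1].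
have l0 : 0 < ln (eps0^-1) by rewrite ln_gt0// invf_gt1.
have lc : 0 <= ln (c^-1) by rewrite ln_ge0// invf_ge1.
pose D := 11 + kappa; have D0 : 0 <= D by rewrite addr_ge0// ltW.
pose B := cN * Num.sqrt (8 + kappa) * (cL * D ^+ 3).
have B0 : 0 <= B by rewrite !mulr_ge0 ?exprn_ge0 ?sqrtr_ge0// ltW.
pose P := 5 + cB%:R * D ^+ 2.
have P0 : 0 <= P by rewrite addr_ge0// mulr_ge0// exprn_ge0.
exists (P / ln (eps0^-1) + B * (ln (c^-1) / ln (eps0^-1) + 1)).
  by rewrite !(addr_ge0, divr_ge0, mulr_ge0)// ltW.
move=> m K eps m0 Km e0 ee0; have m1 : 1 <= m%:R :> R by rewrite ler1n.
have mp : 0 < m%:R :> R by rewrite ltr0n.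
rewrite powR_seven_halves//; set l := ln (eps^-1).
have le0 : 0 <= l by rewrite ln_ge0// invf_ge1// (le_trans ee0)// ltW.
have dim : (11 * m + K)%:R <= D * m%:R.
  by rewrite natrD natrM /D [leRHS]mulrDl lerD2l.
have nu : Num.sqrt (8 * m + K)%:R <= Num.sqrt (8 + kappa) * Num.sqrt m%:R.
  rewrite -sqrtrM ?addr_ge0 ?(ltW k0)// ler_wsqrtr//.
  by rewrite natrD natrM [leRHS]mulrDl lerD2l.
have sm : 1 <= Num.sqrt m%:R :> R by rewrite -[leLHS]sqrtr1 ler_wsqrtr.
have m3 : 1 <= m%:R ^+ 3 :> R by rewrite exprn_ege1.
set M := m%:R ^+ 3 * Num.sqrt m%:R.
have M1 : 1 <= M by rewrite mulr_ege1.
have m2M : m%:R ^+ 2 <= M.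
  apply: (@le_trans _ _ (m%:R ^+ 3)); first by rewrite ler_weXn2l.
  by rewrite ler_peMr// exprn_ge0.
have lM : P <= P / ln (eps0^-1) * l by exact: le_log_scaled.
have llc : ln (c^-1) <= ln (c^-1) / ln (eps0^-1) * l by exact: le_log_scaled.
have lnc : ln ((c * eps)^-1) = ln (c^-1) + l.
  by rewrite invfM lnM ?posrE ?invr_gt0.
have h1 : 5 + cB%:R * (11 * m + K)%:R ^+ 2 <= P * M.
  rewrite /P mulrDl lerD ?ler_peMr// -mulrA ler_wpM2l//.
  apply: (@le_trans _ _ ((D * m%:R) ^+ 2)).
    by rewrite lerXn2r ?nnegrE ?mulr_ge0.
  by rewrite exprMn ler_wpM2l// exprn_ge0.
have h2 : cN * Num.sqrt (8 * m + K)%:R * ln ((c * eps)^-1) *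
      (cL * (11 * m + K)%:R ^+ 3) <= B * M * ln ((c * eps)^-1).
  rewrite lnc mulrAC.
  have -> : B * M = cN * (Num.sqrt (8 + kappa) * Num.sqrt m%:R) *
      (cL * (D * m%:R) ^+ 3) by rewrite /B /M; ring.
  rewrite ler_wpM2r ?addr_ge0//.
  rewrite ler_pM ?mulr_ge0 ?exprn_ge0 ?sqrtr_ge0 ?(ltW N0) ?(ltW L0)//.
    by rewrite ler_wpM2l// ltW.
  rewrite ler_wpM2l ?(ltW L0)// lerXn2r ?nnegrE ?mulr_ge0//.
rewrite addrA; apply: le_trans (lerD h1 h2) _.
rewrite lnc [leRHS]mulrDl lerD//.
  rewrite [M * l]mulrC [leRHS]mulrA.
  by apply: ler_wpM2r; first exact: le_trans M1.
have -> : B * (ln c^-1 / ln eps0^-1 + 1) * (M * l) =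
  B * M * (ln c^-1 / ln eps0^-1 * l + l) by ring.
by rewrite ler_wpM2l ?lerD2r// mulr_ge0// (le_trans ler01).
Qed.

End Asymptotics.

Theorem proposition3 (R : realType) (eps0 kappa W c_tol c_sub cN cL : R)
    (cB : nat) (h_eps0 : 0 < eps0 < 1) (h_kappa : 0 < kappa) (h_W : 0 < W)
    (h_tol : 0 < c_tol) (h_sub : 0 < c_sub) (h_sum : c_tol + c_sub <= 1)
    (h_cN : 0 < cN) (h_cL : 0 < cL) :
  exists C : R,
  forall (m K : nat) (I : mnl_data R m K) (S : conic_solver R)
    (eps theta_min theta_max : R),
    (0 < m)%N -> K%:R <= kappa * m%:R -> mnl_well_posed I ->
    accurate_solver S -> 0 < eps ->
    theta_min <= theta_star I <= theta_max ->
    let run := mnl_bisection I S cB (c_tol * eps) (c_sub * eps)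
                 theta_min theta_max in
    (exists theta_hat ops, run theta_hat ops) /\
    forall theta_hat ops, run theta_hat ops ->
      `|theta_hat - theta_star I| <= eps /\
      (ipm_cost_model eps0 cN cL S -> eps <= eps0 ->
       theta_max - theta_min <= W ->
       ops%:R <= C * m%:R `^ (7 / 2) * ln (eps^-1) ^+ 2).
Proof.
have [A1 A10 hA1] := halving_count h_eps0 h_W h_tol.
have c_sub01 : 0 < c_sub <= 1 by rewrite h_sub/=; lra.
have [A2 A20 hA2] :=
  query_cost_asymptotic cB h_eps0 h_kappa h_cN h_cL c_sub01.
case/andP: (h_eps0) => e00 e01.
have l0 : 0 < ln (eps0^-1) by rewrite ln_gt0// invf_gt1.
exists (2 / ln (eps0^-1) / ln (eps0^-1) + A1 * A2).
move=> m K I S eps theta_min theta_max m0 Km wpI acc eps_gt0 bracket /=.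
have tol0 : 0 < c_tol * eps by exact: mulr_gt0.
have delta0 : 0 < c_sub * eps by exact: mulr_gt0.
have tol_delta : c_tol * eps + c_sub * eps <= eps.
  by rewrite -mulrDl ler_piMl// ltW.
split=> [|th ops run]; first exact: bisection_halts.
split=> [|cost eps_eps0 width].
  have near : theta_min - c_sub * eps <= theta_star I
      <= theta_max + c_sub * eps.
    by case/andP: bracket => *; apply/andP; split; lra.
  have /andP[lo hi] := bisection_localizes
    (fun t => query_up wpI delta0 acc) (fun t => query_down wpI delta0 acc)
    run near.
  by rewrite ler_norml; apply/andP; split; lra.
have [n hW hn] := hA1 eps eps_gt0 eps_eps0.
have delta_eps0 : c_sub * eps <= eps0.
  apply: le_trans eps_eps0; case/andP: c_sub01 => _ c1.
  by rewrite ler_piMl// ltW.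
have hq t := query_cost cB wpI delta0 t (ltW h_cL) cost delta_eps0.
have := hq 0; set q := (X in _ <= X) => q_ge.
have q0 : 0 <= q by exact: le_trans q_ge.
have := bisection_cost q0 hq run (le_trans width hW) => /le_trans; apply.
have := hA2 m K eps m0 Km eps_gt0 eps_eps0; rewrite -/q.
set M := m%:R `^ (7 / 2); set l := ln (eps^-1) => hq5.
have M1 : 1 <= M.
  by rewrite -[leLHS](powRr0 m%:R) ler_powR ?ler1n.
rewrite -mulrA mulrDl lerD//.
  (* The exit cost [2] has no logarithmic factor, so the lower bound on
     [ln (1 / eps)] is used once for each of the two factors. *)
  have absorb x : 0 <= x -> x <= x / ln eps0^-1 * l.
    exact: le_log_scaled eps_gt0 eps_eps0 e01.
  have le0 : 0 <= l by rewrite ln_ge0// invf_ge1// (le_trans eps_eps0)// ltW.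
  have c0 : 0 <= 2 / ln eps0^-1 by rewrite divr_ge0// ltW.
  apply: le_trans (absorb 2 ltac:(lra)) _.
  apply: le_trans (ler_wpM2r le0 (absorb _ c0)) _.
  rewrite -[leLHS]mulrA -expr2 ler_wpM2l ?divr_ge0 ?(ltW l0)//.
  by rewrite ler_peMl// exprn_ge0.
have -> : A1 * A2 * (M * l ^+ 2) = (A1 * l) * (A2 * (M * l)) by ring.
by rewrite ler_pM// addr_ge0.
Qed.
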